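(* Let $A\in\mathbb{R}^{n\times n}$ be a diagonal matrix and let $\mathcal{C}\subseteq\pi_{\mathcal{T}}(\mathbb{B}_{\mathrm{op}}(n))$ be a nonempty closed convex set. Then $$\sup_{X\in\mathrm{O}(n)}\{\langle A,X\rangle:\ \pi_{\mathcal{T}}(X)\in\mathcal{C}\}=\max_{X\in\mathbb{B}_{\mathrm{op}}(n)}\{\langle A,X\rangle:\ \pi_{\mathcal{T}}(X)\in\mathcal{C}\}.$$ If additionally $\det(A)\geq 0$, then $$\sup_{X\in\mathrm{SO}(n)}\{\langle A,X\rangle:\ \pi_{\mathcal{T}}(X)\in\mathcal{C}\}=\sup_{X\in\mathrm{O}(n)}\{\langle A,X\rangle:\ \pi_{\mathcal{T}}(X)\in\mathcal{C}\}=\max_{X\in\mathbb{B}_{\mathrm{op}}(n)}\{\langle A,X\rangle:\ \pi_{\mathcal{T}}(X)\in\mathcal{C}\}.$$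
   Context: $\mathrm{O}(n)=\{X\in\mathbb{R}^{n\times n}:X^\intercal X=I\}$; $\mathrm{SO}(n)=\{X\in\mathrm{O}(n):\det(X)=1\}$; $\mathbb{B}_{\mathrm{op}}(n)=\{X\in\mathbb{R}^{n\times n}:\|X\|_{\mathrm{op}}\le1\}$ is the operator norm (maximum singular value) ball. $\langle A,X\rangle=\operatorname{tr}(A^\intercal X)$. The map $\pi_{\mathcal{T}}:\mathbb{R}^{n\times n}\to\mathbb{R}^{\binom n2}$, $\pi_{\mathcal{T}}(X)=(X_{ij})_{i<j}$, is the projection onto the strictly upper triangular entries. The supremum over an empty (infeasible) set is defined to be $-\infty$. *)

(* Defs.v *)
From HB Require Import structures.
From mathcomp Require Import all_boot all_order all_algebra.
From mathcomp Require Import all_classical all_reals all_analysis.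
Import Order.TTheory GRing.Theory Num.Theory.
Import numFieldNormedType.Exports.

Set Implicit Arguments.
Unset Strict Implicit.
Unset Printing Implicit Defensive.

Local Open Scope classical_set_scope.
Local Open Scope ring_scope.

Definition mxinner (R : realType) (n : nat) (A X : 'M[R]_n) : R :=
  \tr (A^T *m X).

Definition orthogonal_mx (R : realType) (n : nat) : set 'M[R]_n :=
  [set X | X^T *m X = 1%:M].

Definition special_orthogonal_mx (R : realType) (n : nat) : set 'M[R]_n :=
  [set X | orthogonal_mx X /\ \det X = 1].

(* The library norm on matrices is the entrywise maximum, so the Euclidean
   norm has to be spelled out. *)
Definition l2norm (R : realType) (n : nat) (v : 'cV[R]_n) : R :=
  Num.sqrt (\sum_(i < n) v i 0 ^+ 2).

(* The norm of v |-> X *m v induced by the Euclidean norm. The set is nonempty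
   and bounded ([opnorm_has_sup]), so this is a genuine supremum. *)
Definition opnorm (R : realType) (n : nat) (X : 'M[R]_n) : R :=
  sup [set l2norm (X *m v) | v in [set v : 'cV[R]_n | l2norm v <= 1]].

Definition op_ball (R : realType) (n : nat) : set 'M[R]_n :=
  [set X | opnorm X <= 1].

Definition upper_idx (n : nat) : {set 'I_n * 'I_n} :=
  [set p : 'I_n * 'I_n | (p.1 < p.2)%N]%SET.

(* Coordinates are listed in the order of [enum (upper_idx n)]; by
   [card_upper_idx] there are 'C(n, 2) of them. *)
Definition upper_proj (R : realType) (n : nat) (X : 'M[R]_n) :
    'rV[R]_#|upper_idx n| :=
  \row_k X (enum_val k).1 (enum_val k).2.

Definition objective_values (R : realType) (n : nat) (A : 'M[R]_n)
    (S : set 'M[R]_n) (C : set 'rV[R]_#|upper_idx n|) : set (\bar R) :=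
  [set (mxinner A X)%:E | X in [set X | S X /\ C (upper_proj X)]].

(* [ereal_sup set0 = -oo], so an infeasible problem has value -oo. *)
Definition sup_value (R : realType) (n : nat) (A : 'M[R]_n)
    (S : set 'M[R]_n) (C : set 'rV[R]_#|upper_idx n|) : \bar R :=
  ereal_sup (objective_values A S C).

Definition is_max_value (R : realType) (n : nat) (A : 'M[R]_n)
    (S : set 'M[R]_n) (C : set 'rV[R]_#|upper_idx n|) (m : \bar R) : Prop :=
  objective_values A S C m /\ ubound (objective_values A S C) m.

Lemma card_upper_idx (n : nat) : #|upper_idx n| = 'C(n, 2).
Proof.
rewrite -bin2_sum big_mkord -sum1dep_card.
rewrite -(pair_big_dep xpredT (fun i j : 'I_n => (i < j)%N)
            (fun _ _ => 1%N)) /=.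
rewrite (exchange_big_dep xpredT) //=; apply: eq_bigr => j _.
by rewrite -(big_ord_widen n (fun=> 1%N) (ltnW (ltn_ord j))) sum1_card card_ord.
Qed.

Lemma opnorm_has_sup (R : realType) (n : nat) (X : 'M[R]_n) :
  has_sup [set l2norm (X *m v) | v in [set v : 'cV[R]_n | l2norm v <= 1]].
Proof.
split.
  exists (l2norm (X *m 0)), 0 => //=.
  by rewrite /l2norm big1 ?sqrtr0// => i _; rewrite mxE expr0n.
exists (Num.sqrt (\sum_i (\sum_j `|X i j|) ^+ 2)) => _ [v /= v1 <-].
rewrite ler_sqrt ?sumr_ge0// => [|i _]; last exact: sqr_ge0.
apply: ler_sum => i _; rewrite -(real_normK (num_real ((X *m v) i 0))).
rewrite lerXn2r ?nnegrE ?sumr_ge0//= mxE.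
apply: le_trans (ler_norm_sum _ _ _) _; apply: ler_sum => j _.
rewrite normrM ler_piMr//; apply: le_trans v1.
rewrite -sqrtr_sqr ler_sqrt ?sumr_ge0// => [|k _]; last exact: sqr_ge0.
by rewrite (bigD1 j)//= lerDl sumr_ge0// => k _; exact: sqr_ge0.
Qed.

(* Main.v *)
(* Dropping the convexity of C, it is enough to show that every X in the operator
   norm ball is dominated by an orthogonal Q with the same strictly upper
   triangular part, and with det Q = 1 when det A >= 0.  After a perturbation and a
   passage to the limit (O(n) is compact), A is invertible and X = s X' with s < 1
   and X' in the ball.  The dual problem then minimizes the nuclear norm of A + U
   minus <U, X> over strictly upper triangular U; it is coercive, so a minimizer U
   exists.  Since det (A + U) = det A is nonzero, the nuclear norm is differentiable
   at A + U, with gradient the orthogonal polar factor Q of A + U.  Stationarity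
   says that Q and X have the same strictly upper triangular part, so
   <A, Q> = <A + U, Q> - <U, X> >= <A + U, X> - <U, X> = <A, X>,
   and det Q has the sign of det A. *)

Require Import Defs.
From HB Require Import structures.
From mathcomp Require Import all_boot all_order all_algebra.
From mathcomp Require Import all_classical all_reals all_analysis.
From mathcomp Require Import perm ring lra.
Import Order.TTheory GRing.Theory Num.Theory.
Import numFieldNormedType.Exports.

Set Implicit Arguments.
Unset Strict Implicit.
Unset Printing Implicit Defensive.

Local Open Scope classical_set_scope.
Local Open Scope ring_scope.

(** * The trace inner product *)

Section Inner.
Context {R : realType} {n : nat}.
Implicit Types A B X Y : 'M[R]_n.

Lemma mxinnerE A X : mxinner A X = \sum_i \sum_j A i j * X i j.
Proof.
rewrite /mxinner /mxtrace exchange_big /=; apply: eq_bigr => i _.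
by rewrite mxE; apply: eq_bigr => j _; rewrite mxE.
Qed.

Lemma mxinnerC A X : mxinner A X = mxinner X A.
Proof.
by rewrite !mxinnerE; apply: eq_bigr => i _; apply: eq_bigr => j _; rewrite mulrC.
Qed.

Lemma mxinnerDr A X Y : mxinner A (X + Y) = mxinner A X + mxinner A Y.
Proof. by rewrite /mxinner mulmxDr mxtraceD. Qed.

Lemma mxinnerZr A c X : mxinner A (c *: X) = c * mxinner A X.
Proof. by rewrite /mxinner -scalemxAr mxtraceZ. Qed.

Lemma mxinnerNr A X : mxinner A (- X) = - mxinner A X.
Proof. by rewrite -scaleN1r mxinnerZr mulN1r. Qed.

Lemma mxinnerBr A X Y : mxinner A (X - Y) = mxinner A X - mxinner A Y.
Proof. by rewrite mxinnerDr mxinnerNr. Qed.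

Lemma mxinnerDl A B X : mxinner (A + B) X = mxinner A X + mxinner B X.
Proof. by rewrite mxinnerC mxinnerDr !(mxinnerC X). Qed.

Lemma mxinnerZl A c X : mxinner (c *: A) X = c * mxinner A X.
Proof. by rewrite mxinnerC mxinnerZr mxinnerC. Qed.

Lemma mxinnerBl A B X : mxinner (A - B) X = mxinner A X - mxinner B X.
Proof. by rewrite mxinnerC mxinnerBr !(mxinnerC X). Qed.

Lemma mxinner_delta A i j : mxinner A (delta_mx i j) = A i j.
Proof.
rewrite mxinnerE (bigD1 i) //= (bigD1 j) //= mxE !eqxx mulr1 !big1 ?addr0 //.
  move=> k ki; apply: big1 => l _; rewrite mxE (negbTE ki) /= mulr0 //.
by move=> k kj; rewrite mxE (negbTE kj) andbF mulr0.
Qed.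

Lemma mxinner_mulr Y Z X : mxinner Y (Z *m X) = mxinner (Z^T *m Y) X.
Proof. by rewrite /mxinner trmx_mul trmxK mulmxA. Qed.

Lemma mxinner_le A X :
  (forall i j, `|X i j| <= 1) -> `|mxinner A X| <= \sum_i \sum_j `|A i j|.
Proof.
move=> X1; rewrite mxinnerE; apply: le_trans (ler_norm_sum _ _ _) _.
apply: ler_sum => i _; apply: le_trans (ler_norm_sum _ _ _) _.
by apply: ler_sum => j _; rewrite normrM ler_piMr.
Qed.

End Inner.

(** * Bilinear forms and the Cauchy-Schwarz inequality *)

Section Quadratic.
Context {R : realType} {n : nat}.
Implicit Types (S W X : 'M[R]_n) (u v w : 'cV[R]_n).

Definition bform S u v : R := (u^T *m S *m v) 0 0.

Lemma bformDl S u v w : bform S (u + v) w = bform S u w + bform S v w.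
Proof. by rewrite /bform linearD !mulmxDl mxE. Qed.

Lemma bformDr S u v w : bform S u (v + w) = bform S u v + bform S u w.
Proof. by rewrite /bform mulmxDr mxE. Qed.

Lemma bformZl S c u v : bform S (c *: u) v = c * bform S u v.
Proof. by rewrite /bform linearZ /= -!scalemxAl mxE. Qed.

Lemma bformZr S c u v : bform S u (c *: v) = c * bform S u v.
Proof. by rewrite /bform -scalemxAr mxE. Qed.

Lemma bformB S W u v : bform (S - W) u v = bform S u v - bform W u v.
Proof. by rewrite /bform mulmxBr mulmxBl !mxE. Qed.

Lemma bformZ S c u v : bform (c *: S) u v = c * bform S u v.
Proof. by rewrite /bform -scalemxAr -scalemxAl mxE. Qed.

Lemma bform_mx_mul S W u : bform S (W *m u) (W *m u) = bform (W^T *m S *m W) u u.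
Proof. by rewrite /bform trmx_mul !mulmxA. Qed.

Lemma bform_delta S i j : bform S (delta_mx i 0) (delta_mx j 0) = S i j.
Proof. by rewrite /bform trmx_delta -rowE -colE !mxE. Qed.

Lemma bform1 u : bform 1%:M u u = \sum_i u i 0 ^+ 2.
Proof.
by rewrite /bform mulmx1 mxE; apply: eq_bigr => i _; rewrite mxE expr2.
Qed.

Lemma bform1_ge0 u : 0 <= bform 1%:M u u.
Proof. by rewrite bform1 sumr_ge0 // => i _; rewrite sqr_ge0. Qed.

Lemma bform1_eq0 u : bform 1%:M u u = 0 -> u = 0.
Proof.
rewrite bform1 => /eqP; rewrite psumr_eq0 => [/allP u0|i _]; last exact: sqr_ge0.
apply/colP => i; rewrite mxE; apply/eqP; rewrite -sqrf_eq0.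
exact: (u0 i (mem_index_enum i)).
Qed.

Definition psd S := S^T = S /\ forall v, 0 <= bform S v v.

Lemma bform_sym S u v : S^T = S -> bform S u v = bform S v u.
Proof.
move=> sS; rewrite /bform -[RHS]trace_mx11 -mxtrace_tr trace_mx11.
by rewrite !trmx_mul trmxK sS mulmxA.
Qed.

Lemma psd_cauchy_schwarz S u v :
  psd S -> bform S u v ^+ 2 <= bform S u u * bform S v v.
Proof.
move=> [sS pS]; set a := bform S u u; set b := bform S u v; set c := bform S v v.
have key s t : 0 <= s ^+ 2 * a + 2 * s * t * b + t ^+ 2 * c.
  have := pS (s *: u + t *: v).
  rewrite !(bformDl, bformDr, bformZl, bformZr) (bform_sym v u sS) -/a -/b -/c.
  by congr (_ <= _); ring.
have [c0|c0] := eqVneq c 0; last first.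
  have cp : 0 < c by rewrite lt_def c0 pS.
  (* At [s = c], [t = - b] the quadratic form factors as [c * (a * c - b ^+ 2)]. *)
  have /= := key c (- b).
  have -> : c ^+ 2 * a + 2 * c * (- b) * b + (- b) ^+ 2 * c =
    c * (a * c - b ^+ 2) by ring.
  by rewrite pmulr_rge0 // subr_ge0.
have [->|b0] := eqVneq b 0; first by rewrite c0 expr0n mulr0.
(* With [c = 0] the form at [s = 1] is affine in [t] with slope [2 * b]; this [t] gives it the value
   [-1]. *)
have := key 1 (- (a + 1) / (2 * b)); rewrite c0.
have -> : 1 ^+ 2 * a + 2 * 1 * (- (a + 1) / (2 * b)) * b +
   (- (a + 1) / (2 * b)) ^+ 2 * 0 = -1.
  by field.
by rewrite lerNr oppr0 ler10.
Qed.

End Quadratic.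

(** * Gram factorization of positive semidefinite matrices, and contractions *)

Section Gram.
Context {R : realType} {n : nat}.
Implicit Types (S W X L : 'M[R]_n) (u v w : 'cV[R]_n).

Lemma bform_rank1 (c : 'cV[R]_n) v : bform (c *m c^T) v v = ((c^T *m v) 0 0) ^+ 2.
Proof.
rewrite /bform mulmxA -mulmxA mxE big_ord1 expr2; congr (_ * _).
by rewrite -trace_mx11 -mxtrace_tr trace_mx11 trmx_mul trmxK.
Qed.

(* One step of Cholesky elimination clears the diagonal entry of index [k]. *)
Lemma psd_gram_aux (k : nat) S : psd S ->
  (forall i : 'I_n, (k <= i)%N -> S i i = 0) ->
  exists2 L, S = L *m L^T & forall i (j : 'I_n), (k <= j)%N -> L i j = 0.
Proof.
have diag0 S' i j : psd S' -> S' i i = 0 -> S' i j = 0.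
  move=> pS Sii; have := psd_cauchy_schwarz (delta_mx i 0) (delta_mx j 0) pS.
  rewrite !bform_delta Sii mul0r => S0; apply/eqP.
  by rewrite -sqrf_eq0 eq_le S0 sqr_ge0.
elim: k S => [|k IH] S pS S0.
  exists 0 => [|i j _]; last by rewrite mxE.
  by rewrite mul0mx; apply/matrixP => i j; rewrite mxE diag0 // S0.
have [kn|nk] := ltnP k n; last first.
  have nok (j : 'I_n) : (k <= j)%N -> False.
    by move=> kj; have := leq_trans nk kj; rewrite leqNgt ltn_ord.
  have [//|L SL L0] := IH S pS; first by move=> i /nok.
  by exists L => // i j kj; rewrite L0 // ltnW.
pose i0 := Ordinal kn.
have ge_k (j : 'I_n) : (k <= j)%N -> j = i0 \/ (k < j)%N.
  by rewrite leq_eqVlt => /predU1P[kj|]; [left; apply/val_inj|right].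
have [Sii|Sii] := eqVneq (S i0 i0) 0.
  have [j /ge_k[->|/S0]//|L SL L0] := IH S pS.
  by exists L => // i j kj; rewrite L0 // ltnW.
have Sp : 0 < S i0 i0 by rewrite lt_def Sii -bform_delta pS.2.
pose c := col i0 S.
(* Elimination with pivot [S i0 i0]. The result stays positive semidefinite by Cauchy-Schwarz
   against the basis vector of index [i0]. *)
pose S' := S - (S i0 i0)^-1 *: (c *m c^T).
have S'E i j : S' i j = S i j - (S i0 i0)^-1 * (S i i0 * S j i0).
  by rewrite !mxE big_ord1 !mxE.
have pS' : psd S'.
  split.
    by rewrite linearB linearZ /= trmx_mul trmxK pS.1.
  move=> v; rewrite bformB bformZ.
  have -> : bform (c *m c^T) v v = bform S (delta_mx i0 0) v ^+ 2.
    by rewrite bform_rank1 /c colE trmx_mul pS.1.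
  rewrite subr_ge0 mulrC ler_pdivrMr // mulrC -(bform_delta S i0 i0).
  exact: psd_cauchy_schwarz.
have [|L' SL L0] := IH S' pS'.
  move=> j /ge_k[->|kj]; rewrite S'E; first by field.
  by rewrite S0 // (diag0 _ _ i0 pS (S0 j kj)) mul0r mulr0 subr0.
(* [d *m d^T] restores the rank-one term removed from [S]. It is inserted as column [i0], which is
   zero in [L'], so the cross terms vanish. *)
pose d := (Num.sqrt (S i0 i0))^-1 *: c.
have Lk : L' *m (delta_mx i0 0 : 'cV_n) = 0.
  by rewrite -colE; apply/colP => i; rewrite !mxE L0.
exists (L' + d *m (delta_mx i0 0)^T); last first.
  move=> i j kj; rewrite mxE L0 1?ltnW // add0r mxE big_ord1 !mxE.
  by rewrite -val_eqE /= gtn_eqF // mulr0.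
have Lk' : (delta_mx i0 0 : 'cV_n)^T *m L'^T = 0 by rewrite -trmx_mul Lk linear0.
rewrite linearD /= trmx_mul trmxK mulmxDl !mulmxDr -SL !mulmxA Lk mul0mx addr0.
rewrite -!mulmxA Lk' mulmx0 add0r (mulmxA (delta_mx i0 0)^T) trmx_delta mul_delta_mx.
have -> : delta_mx 0 0 = 1%:M :> 'M[R]_1.
  by apply/matrixP => a b; rewrite !ord1 !mxE.
rewrite mul1mx /d linearZ /= -scalemxAl -scalemxAr scalerA -expr2 exprVn.
by rewrite sqr_sqrtr ?(ltW Sp) // subrK.
Qed.

Lemma psd_gram S : psd S -> exists L, S = L *m L^T.
Proof.
move=> pS; have [|L SL _] := @psd_gram_aux n S pS; last by exists L.
by move=> i; rewrite leqNgt ltn_ord.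
Qed.

(** The operator norm ball, free of suprema and square roots; [op_ballP] links the two forms. *)
Definition nonexpansive_mx X :=
  forall v, bform 1%:M (X *m v) (X *m v) <= bform 1%:M v v.

(** Expand the squared norm of [v - W *m v], which is nonnegative, and bound that of [W *m v] by
    that of [v]. *)
Lemma nonexpansive_bform_le W v : nonexpansive_mx W -> bform W v v <= bform 1%:M v v.
Proof.
move=> cW; have := bform1_ge0 (v - W *m v).
have bW : bform 1%:M v (W *m v) = bform W v v by rewrite /bform mulmx1 mulmxA.
rewrite -scaleN1r !(bformDl, bformDr, bformZl, bformZr).
rewrite (bform_sym (W *m v)) ?trmx1 // bW.
by have := cW v; lra.
Qed.

Lemma mxinner_gram L W :
  mxinner (L *m L^T) W = \sum_i bform W (col i L) (col i L).
Proof.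
rewrite /mxinner trmx_mul trmxK -mulmxA mxtrace_mulC /mxtrace.
apply: eq_bigr => i _.
by rewrite !colE bform_mx_mul bform_delta.
Qed.

End Gram.

(** * Orthogonal matrices, and positive semidefiniteness from optimality of the identity *)

Section Orthogonal.
Context {R : realType} {n : nat}.
Implicit Types (S W X L Z Q : 'M[R]_n) (u v w : 'cV[R]_n).

(** With [S = L *m L^T], the pairing is the sum of the quadratic form of [W] over the columns of
    [L], so the bound holds column by column. *)
Lemma psd_mxinner_le S W : psd S -> nonexpansive_mx W -> mxinner S W <= mxinner S 1%:M.
Proof.
move=> /psd_gram[L ->] cW; rewrite !mxinner_gram.
by apply: ler_sum => i _; exact: nonexpansive_bform_le.
Qed.

Lemma orthogonal_nonexpansive Q : orthogonal_mx Q -> nonexpansive_mx Q.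
Proof. by move=> oQ v; rewrite bform_mx_mul mulmx1 oQ. Qed.

Lemma orthogonal1 : orthogonal_mx (1%:M : 'M[R]_n).
Proof. by rewrite /orthogonal_mx /= trmx1 mulmx1. Qed.

Lemma orthogonalM Q W : orthogonal_mx Q -> orthogonal_mx W -> orthogonal_mx (Q *m W).
Proof.
rewrite /orthogonal_mx /= => oQ oW.
by rewrite trmx_mul mulmxA -(mulmxA W^T) oQ mulmx1.
Qed.

Lemma orthogonalT Q : orthogonal_mx Q -> orthogonal_mx Q^T.
Proof. by rewrite /orthogonal_mx /= trmxK => /mulmx1C. Qed.

Lemma orthogonal_mul_nonexpansive Q X :
  orthogonal_mx Q -> nonexpansive_mx X -> nonexpansive_mx (Q *m X).
Proof.
by move=> oQ cX v; rewrite -mulmxA; apply: le_trans (orthogonal_nonexpansive oQ _) _.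
Qed.

Lemma orthogonal_det_sqr Q : orthogonal_mx Q -> \det Q ^+ 2 = 1.
Proof. by move=> /(congr1 determinant); rewrite det_mulmx det_tr det1 expr2. Qed.

(* [1 + s K + (1 - c) K^2] is the rotation of angle [(cos, sin) = (c, s)] in the
   plane on which the skew matrix [K] acts as a quarter turn. *)
Lemma orthogonal_rotation (K : 'M[R]_n) (c s : R) :
  K^T = - K -> K *m K *m K = - K -> c ^+ 2 + s ^+ 2 = 1 ->
  orthogonal_mx (1%:M + s *: K + (1 - c) *: (K *m K)).
Proof.
move=> Kt K3 cs; rewrite /orthogonal_mx /= !linearD !linearZ /= trmx1 trmx_mul Kt.
rewrite mulNmx mulmxN opprK.
have K4 : K *m K *m (K *m K) = - (K *m K) by rewrite mulmxA K3 mulNmx.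
have K3' : K *m (K *m K) = - K by rewrite mulmxA.
rewrite !(mulmxDl, mulmxDr) !(mul1mx, mulmx1) -!scalemxAl.
rewrite !mulNmx K3 K4 K3' !scalerN opprK.
apply/matrixP => i j; rewrite !mxE.
set k := \sum_j0 _.
have {cs} : s ^+ 2 = 1 - c ^+ 2 by rewrite -cs addrAC subrr add0r.
by move=> cs; ring: cs.
Qed.

(** The Householder reflection along [v]. *)
Lemma orthogonal_reflection v : bform 1%:M v v != 0 ->
  orthogonal_mx (1%:M - (2 / bform 1%:M v v) *: (v *m v^T)).
Proof.
move=> v0; set a := bform _ _ _.
set P := v *m v^T; have PP : P *m P = a *: P.
  rewrite /P mulmxA -(mulmxA v) [v^T *m v]mx11_scalar.
  by rewrite /a /bform mulmx1 mul_mx_scalar scalemxAl.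
rewrite /orthogonal_mx /= [(_ - _)^T]linearB /= [(_ *: _)^T]linearZ /=.
have -> : P^T = P by rewrite trmx_mul trmxK.
rewrite trmx1 mulmxBr mulmx1 mulmxBl mul1mx -scalemxAl -scalemxAr PP !scalerA.
apply/matrixP => i j; rewrite !mxE; set x := \sum_j0 _.
by field.
Qed.

(** Comparing the identity with small rotations in coordinate planes forces symmetry; comparing it
    with the reflection along [v] forces the quadratic form to be nonnegative at [v]. *)
Lemma orthogonal_max_psd S :
  (forall W, orthogonal_mx W -> mxinner S W <= mxinner S 1%:M) -> psd S.
Proof.
move=> Smax; split.
  apply/matrixP => j i; rewrite mxE.
  have [->//|ij] := eqVneq i j.
  pose K : 'M[R]_n := delta_mx i j - delta_mx j i.
  have KK : K *m K = - (delta_mx i i + delta_mx j j).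
    rewrite /K mulmxBl !mulmxBr !mul_delta_mx_cond !eqxx (eq_sym j i) (negbTE ij) /=.
    by rewrite !mulr0n !mulr1n sub0r subr0 opprD.
  have Kt : K^T = - K by rewrite linearB /= !trmx_delta opprB.
  have K3 : K *m K *m K = - K.
    rewrite KK mulNmx mulmxDl !mulmxBr !mul_delta_mx_cond !eqxx (eq_sym j i).
    by rewrite (negbTE ij) /= !mulr0n !mulr1n sub0r subr0.
  set a := S i j - S j i; set b := S i i + S j j.
  have aE : mxinner S K = a by rewrite mxinnerBr !mxinner_delta.
  have bE : mxinner S (K *m K) = - b.
    by rewrite KK mxinnerNr mxinnerDr !mxinner_delta.
  (* The rational parametrization of the circle supplies the rotations without trigonometry. *)
  have key (t : R) : t * a <= t ^+ 2 * b.
    have t1 : 0 < 1 + t ^+ 2 by rewrite ltr_pwDl // sqr_ge0.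
    have t1' : 1 + t ^+ 2 != 0 by rewrite gt_eqF.
    have cs : ((1 - t ^+ 2) / (1 + t ^+ 2)) ^+ 2 + (2 * t / (1 + t ^+ 2)) ^+ 2 = 1.
      by field.
    have := Smax _ (orthogonal_rotation Kt K3 cs).
    rewrite !mxinnerDr !mxinnerZr aE bE -addrA gerDl.
    have -> : 2 * t / (1 + t ^+ 2) * a + (1 - (1 - t ^+ 2) / (1 + t ^+ 2)) * - b =
      2 / (1 + t ^+ 2) * (t * a - t ^+ 2 * b) by field.
    by rewrite pmulr_rle0 ?divr_gt0 // subr_le0.
  have b1 : 0 < 1 + `|b| by rewrite ltr_pwDl.
  have b1' : 1 + `|b| != 0 by rewrite gt_eqF.
  (* This [t] has the sign of [a] and is small enough for the first-order term to win: [key] becomes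
     [a ^+ 2 * (1 + |b|) <= a ^+ 2 * b], so [a = 0]. *)
  have := key (a / (1 + `|b|)).
  have -> : a / (1 + `|b|) * a = (a ^+ 2 * (1 + `|b|)) / (1 + `|b|) ^+ 2 by field.
  rewrite expr_div_n [leRHS]mulrAC ler_pM2r ?invr_gt0 ?exprn_gt0 //.
  rewrite mulrDr mulr1 => h.
  have : a ^+ 2 * b <= a ^+ 2 * `|b| by rewrite ler_wpM2l ?sqr_ge0 ?ler_norm.
  move=> h'; have : a ^+ 2 <= 0 by lra.
  move=> a0; apply/eqP; rewrite -subr_eq0 -/a -sqrf_eq0 eq_le a0 sqr_ge0 //.
move=> v; have [v0|v0] := eqVneq (bform 1%:M v v) 0.
  by rewrite (bform1_eq0 v0) /bform mulmx0 mxE.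
have := Smax _ (orthogonal_reflection v0).
rewrite mxinnerBr gerBl mxinnerZr pmulr_rge0; last first.
  by rewrite divr_gt0 // lt_def v0 bform1_ge0.
rewrite /mxinner mulmxA mxtrace_mulC mulmxA trace_mx11.
by rewrite -[X in 0 <= X]trace_mx11 -mxtrace_tr trace_mx11 !trmx_mul !trmxK mulmxA.
Qed.

End Orthogonal.

(** * Orthogonal polar factors and the operator norm ball *)

Section Polar.
Context {R : realType} {n : nat}.
Implicit Types (S W X Y Z : 'M[R]_n) (u v w : 'cV[R]_n).

Lemma psd_det_ge0 S : psd S -> 0 <= \det S.
Proof. by move=> /psd_gram[L ->]; rewrite det_mulmx det_tr -expr2 sqr_ge0. Qed.

(** For [D = 1%:M - W], orthogonality gives [D^T *m D = D + D^T]. With [S = L *m L^T], the squared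
    norms of the columns of [D *m L] then sum to [2 * mxinner S D <= 0]. So [D *m L = 0], and [L] is
    invertible. *)
Lemma psd_unit_max1 S W : psd S -> S \in unitmx -> orthogonal_mx W ->
  mxinner S 1%:M <= mxinner S W -> W = 1%:M.
Proof.
move=> pS uS oW SW; have [L SL] := psd_gram pS.
pose D := 1%:M - W.
have DD : D^T *m D = D + D^T.
  rewrite /D [(_ - _)^T]linearB /= trmx1 mulmxBl mul1mx mulmxBr mulmx1 oW opprB.
  by rewrite addrA.
have SD : mxinner S (D^T *m D) <= 0.
  rewrite DD mxinnerDr.
  have -> : mxinner S D^T = mxinner S D.
    by rewrite /mxinner -mxtrace_tr trmx_mul !trmxK mxtrace_mulC pS.1.
  by rewrite mxinnerBr; lra.
have DL : D *m L = 0.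
  apply/matrixP => k i; suff /colP/(_ k) : D *m col i L = 0.
    by rewrite colE mulmxA -colE !mxE.
  apply: bform1_eq0; apply/eqP.
  rewrite bform_mx_mul mulmx1.
  move: SD; rewrite SL mxinner_gram => SD.
  have ge0 j : 0 <= bform (D^T *m D) (col j L) (col j L).
    by rewrite -[D^T]mulmx1 -bform_mx_mul bform1_ge0.
  have /eqP : \sum_j bform (D^T *m D) (col j L) (col j L) = 0.
    by apply/eqP; rewrite eq_le SD sumr_ge0.
  by rewrite psumr_eq0 // => /allP/(_ i (mem_index_enum i)).
have uL : L \in unitmx by move: uS; rewrite SL unitmx_mul => /andP[].
have : D = 0 by rewrite -[D](mulmxK uL) DL mul0mx.
by move=> /eqP; rewrite subr_eq0 => /eqP.
Qed.

(** An orthogonal polar factor of [Y]: [Z^T *m Y] is positive semidefinite by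
    [orthogonal_argmax_psd]. In this variational form, existence follows from compactness and no
    singular value decomposition is used. *)
Definition orthogonal_argmax Y Z :=
  orthogonal_mx Z /\ forall W, orthogonal_mx W -> mxinner Y W <= mxinner Y Z.

Lemma mxinner_orthogonalT Y Z W : orthogonal_mx Z ->
  mxinner (Z^T *m Y) (Z^T *m W) = mxinner Y W.
Proof.
by move=> /mulmx1C oZ; rewrite -mxinner_mulr mulmxA oZ mul1mx.
Qed.

Lemma orthogonal_argmax_psd Y Z : orthogonal_argmax Y Z -> psd (Z^T *m Y).
Proof.
move=> [oZ maxZ]; apply: orthogonal_max_psd => W oW.
by rewrite -!mxinner_mulr mulmx1; apply: maxZ; exact: orthogonalM.
Qed.

(** Multiplication by [Z^T] moves the maximizer to the identity and [Y] to a positive semidefinite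
    matrix, where [psd_mxinner_le] applies. *)
Lemma orthogonal_argmax_nonexpansive Y Z X :
  orthogonal_argmax Y Z -> nonexpansive_mx X -> mxinner Y X <= mxinner Y Z.
Proof.
move=> maxZ cX; have oZ := maxZ.1.
rewrite -(mxinner_orthogonalT Y X oZ) -(mxinner_orthogonalT Y Z oZ) [Z^T *m Z]oZ.
apply: psd_mxinner_le; first exact: orthogonal_argmax_psd.
by apply: orthogonal_mul_nonexpansive => //; exact: orthogonalT.
Qed.

Lemma orthogonal_argmax_unique Y Z W : Y \in unitmx -> orthogonal_argmax Y Z ->
  orthogonal_mx W -> mxinner Y Z <= mxinner Y W -> W = Z.
Proof.
move=> uY maxZ oW; have oZ := maxZ.1; have oZt := orthogonalT oZ.
rewrite -(mxinner_orthogonalT Y Z oZ) -(mxinner_orthogonalT Y W oZ) [Z^T *m Z]oZ.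
have uS : Z^T *m Y \in unitmx.
  by rewrite unitmx_mul uY andbT; case/mulmx1_unit: oZ.
move=> /(psd_unit_max1 (orthogonal_argmax_psd maxZ) uS (orthogonalM oZt oW)) ZW.
by rewrite -[W]mul1mx -(mulmx1C oZ) -mulmxA ZW mulmx1.
Qed.

(** The positive semidefinite matrix [Z^T *m Y] has determinant [\det Z * \det Y >= 0], and [\det Z]
    squares to 1. *)
Lemma orthogonal_argmax_det Y Z : orthogonal_argmax Y Z -> 0 < \det Y -> \det Z = 1.
Proof.
move=> maxZ Y0; have := psd_det_ge0 (orthogonal_argmax_psd maxZ).
rewrite det_mulmx det_tr pmulr_lge0 // => Z0; apply/eqP.
by rewrite -sqrp_eq1 //; apply/eqP/orthogonal_det_sqr/maxZ.1.
Qed.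

Lemma nonexpansive_delta (c : R) i j :
  `|c| <= 1 -> nonexpansive_mx (c *: delta_mx i j : 'M[R]_n).
Proof.
move=> c1 v; rewrite bform_mx_mul mulmx1.
rewrite -scalemxAr [(_ *: _)^T]linearZ /= -scalemxAl scalerA trmx_delta mul_delta_mx.
have -> : delta_mx j j = delta_mx j (0 : 'I_1) *m delta_mx 0 j :> 'M[R]_n.
  by rewrite mul_delta_mx.
rewrite -(trmx_delta _ j (0 : 'I_1)) bformZ bform_rank1.
rewrite trmx_delta -rowE mxE.
have c2 : c * c <= 1 by rewrite -expr2 -real_normK ?num_real // exprn_ile1.
apply: le_trans (ler_wpM2r (sqr_ge0 _) c2) _.
by rewrite mul1r bform1 (bigD1 j) //= lerDl sumr_ge0 // => k _; exact: sqr_ge0.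
Qed.

Lemma nonexpansive_coord X i j : nonexpansive_mx X -> `|X i j| <= 1.
Proof.
move=> /(_ (delta_mx j 0)); rewrite bform_delta mxE eqxx -colE bform1 => X1.
rewrite -(@expr_le1 _ 2) // real_normK ?num_real //.
apply: le_trans X1; rewrite (bigD1 i) //= mxE lerDl sumr_ge0 // => k _.
exact: sqr_ge0.
Qed.

(** By homogeneity it suffices to test the supremum on normalized vectors; the zero vector is
    treated apart. *)
Lemma op_ballP X : op_ball X <-> nonexpansive_mx X.
Proof.
have l2E v : l2norm v ^+ 2 = bform 1%:M v v.
  by rewrite sqr_sqrtr ?bform1 // -bform1 bform1_ge0.
have l2_le1 v : (l2norm v <= 1) = (bform 1%:M v v <= 1).
  by rewrite -l2E expr_le1 ?sqrtr_ge0.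
split=> [X1 v|cX].
  have [v0|v0] := eqVneq (bform 1%:M v v) 0.
    by rewrite (bform1_eq0 v0) mulmx0.
  have vp : 0 < bform 1%:M v v by rewrite lt_def v0 bform1_ge0.
  pose w := (l2norm v)^-1 *: v.
  have bw Y : bform 1%:M (Y *m w) (Y *m w) =
      bform 1%:M (Y *m v) (Y *m v) / bform 1%:M v v.
    by rewrite /w -scalemxAr bformZl bformZr mulrA -expr2 exprVn l2E mulrC.
  have w1 : l2norm w <= 1.
    by rewrite l2_le1 -[w]mul1mx bw !mul1mx divff.
  have : l2norm (X *m w) <= 1.
    apply: le_trans X1; apply: ub_le_sup; first exact: (opnorm_has_sup X).2.
    by exists w.
  by rewrite l2_le1 bw ler_pdivrMr // mul1r.
apply: ge_sup; first exact: (opnorm_has_sup X).1.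
by move=> _ [v /= v1 <-]; move: v1; rewrite !l2_le1; apply: le_trans.
Qed.

End Polar.

(** * Continuity, compactness and passage to the limit *)

Section Compactness.
Context {R : realType} {n : nat}.
Implicit Types (A V X Y Z Q U : 'M[R]_n) (K : set 'M[R]_n).

Lemma continuous_sumr (T : topologicalType) (I : Type) (r : seq I) (f : I -> T -> R) :
  (forall i, continuous (f i)) -> continuous (fun x => \sum_(i <- r) f i x).
Proof.
move=> cf; elim: r => [|i r IH].
  rewrite (_ : (fun _ => _) = cst 0); last by apply/funext => x; rewrite big_nil.
  exact: cst_continuous.
rewrite (_ : (fun _ => _) = f i \+ fun x => \sum_(i <- r) f i x).
  by move=> x; apply: continuousD; [exact: cf|exact: IH].
by apply/funext => x; rewrite big_cons.
Qed.

Lemma continuous_prodr (T : topologicalType) (I : Type) (r : seq I) (f : I -> T -> R) :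
  (forall i, continuous (f i)) -> continuous (fun x => \prod_(i <- r) f i x).
Proof.
move=> cf; elim: r => [|i r IH].
  rewrite (_ : (fun _ => _) = cst 1); last by apply/funext => x; rewrite big_nil.
  exact: cst_continuous.
rewrite (_ : (fun _ => _) = f i \* fun x => \prod_(i <- r) f i x).
  by move=> x; apply: continuousM; [exact: cf|exact: IH].
by apply/funext => x; rewrite big_cons.
Qed.

Lemma continuous_det : continuous (fun X : 'M[R]_n => \det X).
Proof.
apply: (continuous_sumr
  (f := fun (s : 'S_n) (X : 'M[R]_n) => (-1) ^+ s * \prod_i X i (s i))) => s X.
change ({for X, continuous
  (cst ((-1) ^+ s) \* (fun X : 'M[R]_n => \prod_i X i (s i)))}).
apply: continuousM; first exact: cst_continuous.
by apply: continuous_prodr => i {}X; exact: coord_continuous.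
Qed.

Lemma mx_continuous (T : topologicalType) (p q : nat) (f : T -> 'M[R]_(p, q)) :
  (forall i j, continuous (fun x => f x i j)) -> continuous f.
Proof.
move=> cf x S [P Pn PS].
have Px (ij : 'I_p * 'I_q) : nbhs x [set y | P ij.1 ij.2 (f y ij.1 ij.2)].
  exact/cf/Pn.
by apply: filterS (filter_forall _ Px) => y Py; apply: PS => i j; exact: (Py (i, j)).
Qed.

Lemma continuous_mxinner A : continuous (mxinner A : 'M[R]_n -> R).
Proof.
rewrite (_ : mxinner A = fun X => \sum_i \sum_j A i j * X i j); last first.
  by apply/funext => X; rewrite mxinnerE.
apply: continuous_sumr => i; apply: continuous_sumr => j X.
by apply: continuousM; [exact: cst_continuous|exact: coord_continuous].
Qed.

(** Vectorization turns the box into a product of segments. *)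
Lemma compact_mxbox (b : 'I_n -> 'I_n -> R) :
  compact [set X : 'M[R]_n | forall i j, `|X i j| <= b i j].
Proof.
pose c : 'rV[R]_(n * n) := mxvec (\matrix_(i, j) b i j).
pose B := [set v : 'rV[R]_(n * n) | forall k, `[- c 0 k, c 0 k]%classic (v 0 k)].
have cB : compact B.
  by apply: (rV_compact (A := fun k => `[- c 0 k, c 0 k]%classic)) => k;
    exact: segment_compact.
have -> : [set X : 'M[R]_n | forall i j, `|X i j| <= b i j] = vec_mx @` B.
  apply/seteqP; split=> [X Xb|_ [v Bv <-] i j].
    exists (mxvec X); last by rewrite mxvecK.
    by case/mxvec_indexP=> i j /=; rewrite /c !mxvecE mxE in_itv /= -ler_norml.
  have := Bv (mxvec_index i j).
  by rewrite /c /= mxvecE mxE in_itv /= -ler_norml mxE.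
apply: continuous_compact => //; apply: continuous_subspaceT.
apply: mx_continuous => i j.
rewrite (_ : (fun _ => _) = fun v : 'rV[R]_(n * n) => v 0 (mxvec_index i j)).
  exact: coord_continuous.
by apply/funext => v; rewrite mxE.
Qed.

Lemma compact_orthogonal : compact (@orthogonal_mx R n).
Proof.
refine (@subclosed_compact _ _ _ _ (@compact_mxbox (fun _ _ => 1)) _); last first.
  move=> X oX i j; apply: nonexpansive_coord; exact: orthogonal_nonexpansive.
have -> : @orthogonal_mx R n = \bigcap_(ij in @setT ('I_n * 'I_n))
    ((fun X : 'M[R]_n => \sum_k X k ij.1 * X k ij.2) @^-1`
      [set x | x = (ij.1 == ij.2)%:R]).
  apply/seteqP; split=> [X oX [i j] _|X oX] /=.
    have /matrixP/(_ i j) := oX; rewrite !mxE => <-.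
    by apply: eq_bigr => k _; rewrite mxE.
  apply/matrixP => i j; rewrite !mxE -(oX (i, j) I) /=.
  by apply: eq_bigr => k _; rewrite mxE.
apply: closed_bigI => -[i j] _ /=; apply: preimage_closed; last exact: closed_eq.
move=> X _; apply: continuous_sumr => k {}X.
by apply: continuousM; exact: coord_continuous.
Qed.

Lemma orthogonal_argmax_exists Y : exists Z, orthogonal_argmax Y Z.
Proof.
have [|Z] := compact_EVT_max _ compact_orthogonal
  (continuous_subspaceT (@continuous_mxinner Y)).
  by exists 1%:M; exact: orthogonal1.
by rewrite inE => oZ maxZ; exists Z; split=> // W oW; apply: maxZ; rewrite inE.
Qed.

(** A limit principle for systems of linear inequalities in [Q]: solvability in [K] up to every
    uniform error [e] yields an exact solution. It serves to find a dual minimizer, to prove its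
    stationarity and to remove the final perturbation. *)
Lemma compact_approx_le K (P : 'M[R]_n -> R -> Prop) : compact K ->
  (forall e, 0 < e -> exists2 Q, K Q & forall V b, P V b -> b - e <= mxinner V Q) ->
  exists2 Q, K Q & forall V b, P V b -> b <= mxinner V Q.
Proof.
move=> cK approx.
(* These nested nonempty sets generate a proper filter. A cluster point in [K] lies in every relaxed
   closed half-space, hence in the exact ones. *)
pose D e := [set Q | K Q /\ forall V b, P V b -> b - e <= mxinner V Q].
pose F := filter_from [set e : R | 0 < e] D.
have PF : ProperFilter F.
  apply: filter_from_proper => [|e /approx[Q KQ Qe]]; last by exists Q.
  apply: filter_from_filter => [|e1 e2 /= e1p e2p]; first by exists 1 => /=.
  exists (Num.min e1 e2) => /=; first by rewrite lt_min e1p.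
  move=> Q [KQ Qe]; split; split=> // V b /Qe; apply: le_trans;
    by rewrite lerD2l lerN2 ge_min lexx ?orbT.
have [|Q [KQ clQ]] := cK F PF.
  by exists 1 => //= Q [].
exists Q => // V b PVb; apply/ler_addgt0Pr => e e0; rewrite -lerBlDr.
have cl : closed (mxinner V @^-1` [set x | b - e <= x]).
  by apply: preimage_closed => [X _|]; [exact: continuous_mxinner|exact: closed_ge].
apply: cl => N NQ; have [|X [[_ Xe] NX]] := clQ (D e) N _ NQ; first by exists e.
by exists X; split=> //=; exact: Xe.
Qed.

End Compactness.

(** * The nuclear norm and the dual problem *)

Section Duality.
Context {R : realType} {n : nat}.
Implicit Types (A V X Y Z Q U : 'M[R]_n).

Definition orthogonal_max Y : 'M[R]_n := sval (cid (orthogonal_argmax_exists Y)).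

Lemma orthogonal_maxP Y : orthogonal_argmax Y (orthogonal_max Y).
Proof. exact: svalP. Qed.

(** The sum of the singular values, as the maximum of [mxinner Y] over the orthogonal matrices, or
    equally over the contractions. *)
Definition nuclear_norm Y : R := mxinner Y (orthogonal_max Y).

Lemma mxinner_le_nuclear Y X : nonexpansive_mx X -> mxinner Y X <= nuclear_norm Y.
Proof. exact: orthogonal_argmax_nonexpansive (orthogonal_maxP Y). Qed.

Lemma coord_le_nuclear Y i j : `|Y i j| <= nuclear_norm Y.
Proof.
have dle (c : R) : `|c| <= 1 -> c * Y i j <= nuclear_norm Y.
  move=> c1; rewrite -mxinner_delta -mxinnerZr.
  exact: mxinner_le_nuclear (nonexpansive_delta _ _ c1).
by rewrite ler_norml lerNl -mulN1r -[Y i j]mul1r mulrA mulr1 !dle ?normrN ?normr1.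
Qed.

Lemma nuclear_ge0 Y : 0 <= nuclear_norm Y.
Proof.
have <- : mxinner Y (0 *: 0) = 0 by rewrite mxinnerZr mul0r.
by apply: mxinner_le_nuclear => v; rewrite scale0r mul0mx /bform mulmx0 mxE bform1_ge0.
Qed.

Definition strictly_upper U := forall i j : 'I_n, (j <= i)%N -> U i j = 0.

(** [A + U] is triangular with the diagonal of [A]. Hence every dual point inherits the
    invertibility and the determinant sign of [A]. *)
Lemma strictly_upper_add_diag_det A U : is_diag_mx A -> strictly_upper U ->
  \det (A + U) = \det A.
Proof.
move=> /is_diag_mxP dA uU; rewrite -det_tr det_trig; last first.
  apply/is_trig_mxP => i j ij; rewrite !mxE uU ?(ltnW ij) // addr0 dA //.
  by rewrite gtn_eqF.
rewrite -[RHS]det_tr det_trig; last first.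
  by apply/is_trig_mxP => i j ij; rewrite mxE dA // gtn_eqF.
by apply: eq_bigr => i _; rewrite !mxE uU // addr0.
Qed.

Lemma mxinner_strictly_upper U X Y : strictly_upper U ->
  (forall i j : 'I_n, (i < j)%N -> X i j = Y i j) -> mxinner U X = mxinner U Y.
Proof.
move=> uU XY; rewrite !mxinnerE; apply: eq_bigr => i _; apply: eq_bigr => j _.
by have [ij|ji] := ltnP i j; [rewrite XY|rewrite uU // !mul0r].
Qed.

Section DualProblem.
Variables (A X : 'M[R]_n) (s : R).
Hypotheses (dA : is_diag_mx A) (cX : nonexpansive_mx X) (s0 : 0 <= s) (s1 : s < 1).

(* The Lagrangian dual of maximizing [<A, .>] over the operator norm ball when
   the strictly upper triangular entries are prescribed to be those of [s *: X]. *)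
Definition dual_objective U : R := nuclear_norm (A + U) - s * mxinner U X.

(** Coercivity: as [X] is a contraction, [s * mxinner (A + U) X] consumes at most the fraction [s]
    of the nuclear norm, and [1 - s > 0] of it remains. *)
Lemma dual_objective_ge U :
  (1 - s) * nuclear_norm (A + U) + s * mxinner A X <= dual_objective U.
Proof.
rewrite /dual_objective.
have := ler_wpM2l s0 (mxinner_le_nuclear (A + U) cX); rewrite mxinnerDl; lra.
Qed.

Lemma dual_minimizer_exists : exists2 U, strictly_upper U &
  forall V, strictly_upper V -> dual_objective U <= dual_objective V.
Proof.
pose E := [set dual_objective U | U in strictly_upper].
have infE : has_inf E.
  split; first by exists (dual_objective 0), 0 => // i j _; rewrite mxE.
  exists (s * mxinner A X) => _ [U _ <-].
  apply: le_trans (dual_objective_ge U); rewrite lerDr mulr_ge0 ?nuclear_ge0 //.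
  by rewrite subr_ge0 ltW.
pose m := inf E.
(* By coercivity, [M] bounds the nuclear norm of [A + U], hence its entries, whenever the dual
   objective is at most [m + 1]. *)
pose M := (m + 1 - s * mxinner A X) / (1 - s).
have s1' : 0 < 1 - s by rewrite subr_gt0.
(* Since the nuclear norm is a maximum over [Z], [dual_objective U <= m] amounts to this system of
   inequalities linear in [U]. The box below has width 0 on and under the diagonal, which keeps the
   limit strictly upper triangular. *)
pose P V b := exists2 Z, orthogonal_mx Z & V = s *: X - Z /\ b = mxinner A Z - m.
have [|U Ubox UP] := compact_approx_le (P := P)
    (@compact_mxbox R n (fun i j => if (i < j)%N then M else 0)).
  move=> e e0; have e1 : 0 < Num.min e 1 by rewrite lt_min e0 ltr01.
  have [_ [U uU <-] gU] := inf_adherent e1 infE.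
  exists U.
    move=> i j /=; have [ij|ji] := ltnP i j; last by rewrite uU // normr0.
    have := coord_le_nuclear (A + U) i j.
    rewrite mxE (is_diag_mxP dA) ?(ltn_eqF ij) // add0r => /le_trans; apply.
    rewrite ler_pdivlMr // mulrC lerBrDr; apply: le_trans (dual_objective_ge U) _.
    by apply: ltW; apply: lt_le_trans gU _; rewrite lerD2l ge_min lexx orbT.
  move=> V b [Z oZ [-> ->]]; rewrite mxinnerBl mxinnerZl !(mxinnerC _ U).
  have : dual_objective U <= m + e.
    by apply: ltW; apply: lt_le_trans gU _; rewrite lerD2l ge_min lexx.
  rewrite /dual_objective.
  have := mxinner_le_nuclear (A + U) (orthogonal_nonexpansive oZ).
  by rewrite mxinnerDl; lra.
exists U => [i j ji|V uV].
  by have := Ubox i j; rewrite /= ltnNge ji /= normr_le0 => /eqP.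
have mV : m <= dual_objective V by apply: ge_inf; [exact: infE.2|exists V].
apply: le_trans mV; rewrite /dual_objective /nuclear_norm.
have := UP _ _ (ex_intro2 _ _ _ (orthogonal_maxP (A + U)).1 (conj erefl erefl)).
by rewrite mxinnerBl mxinnerZl !(mxinnerC _ U) mxinnerDl; lra.
Qed.

(* Danskin's argument: maximizers at [A + U + t *: V] accumulate, as [t] tends to
   0+, at the maximizer at [A + U], which is unique since [A + U] is invertible. *)
Lemma dual_stationary U V : A + U \in unitmx -> strictly_upper U ->
  (forall V, strictly_upper V -> dual_objective U <= dual_objective V) ->
  strictly_upper V -> s * mxinner V X <= mxinner V (orthogonal_max (A + U)).
Proof.
move=> uY uU minU uV; set Y := A + U; set Q := orthogonal_max Y.
(* The first inequality makes the limit a maximizer at [Y]; the second is the claimed bound, to be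
   transferred to [Q]. *)
pose P W b := (W = Y /\ b = nuclear_norm Y) \/ (W = V /\ b = s * mxinner V X).
pose l := \sum_i \sum_j `|V i j|.
have l0 : 0 <= l by apply: sumr_ge0 => i _; apply: sumr_ge0.
have Vl Z : orthogonal_mx Z -> `|mxinner V Z| <= l.
  move=> oZ; apply: mxinner_le => i j; apply: nonexpansive_coord.
  exact: orthogonal_nonexpansive.
have [e e0|Z oZ ZP] := compact_approx_le (P := P) (@compact_orthogonal R n).
  (* A maximizer at [Y + t *: V] loses at most [t * (2 * l) <= e] at [Y]; the added 1 avoids a zero
     denominator. *)
  pose t := e / (2 * l + 1).
  have l1 : 0 < 2 * l + 1 by rewrite ltr_wpDl // mulr_ge0.
  have t0 : 0 < t by rewrite divr_gt0.
  pose Z := orthogonal_max (Y + t *: V).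
  have oZ : orthogonal_mx Z := (orthogonal_maxP _).1.
  have := (orthogonal_maxP (Y + t *: V)).2 Q (orthogonal_maxP Y).1.
  have := (orthogonal_maxP Y).2 Z oZ.
  have : dual_objective U <= dual_objective (U + t *: V).
    by apply: minU => i j ji; rewrite !mxE uU // uV // mulr0 addr0.
  rewrite /dual_objective addrA -/Y -/Q /nuclear_norm -/Q -/Z.
  rewrite !(mxinnerDl Y) (mxinnerDl U) !mxinnerZl => gmin QZ ZQ.
  exists Z => // W b [[-> ->]|[-> ->]]; last first.
    (* Minimality of [U] bounds [t * (s * mxinner V X)] by the growth of the nuclear norm from [Y]
       to [Y + t *: V], which is at most [t * mxinner V Z] as [Z] is optimal at the second point. *)
    suff : t * (s * mxinner V X) <= t * mxinner V Z by rewrite ler_pM2l //; lra.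
    by lra.
  rewrite /nuclear_norm -/Q.
  have tl : t * (2 * l) <= e.
    by rewrite /t mulrAC ler_pdivrMr // ler_pM2l // lerDl.
  have : t * (mxinner V Z - mxinner V Q) <= t * (2 * l).
    rewrite ler_pM2l //; have := Vl Z oZ; have := Vl Q (orthogonal_maxP Y).1.
    by rewrite !ler_norml => /andP[? ?] /andP[? ?]; lra.
  by lra.
have -> : Q = Z.
  apply/esym/(orthogonal_argmax_unique uY (orthogonal_maxP Y)) => //.
  by apply: ZP; left.
by apply: ZP; right.
Qed.

Lemma orthogonal_dual : \det A != 0 -> exists Q,
  [/\ orthogonal_mx Q, forall i j : 'I_n, (i < j)%N -> Q i j = s * X i j,
      s * mxinner A X <= mxinner A Q & 0 < \det A -> \det Q = 1].
Proof.
move=> detA; have [U uU minU] := dual_minimizer_exists.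
have detY := strictly_upper_add_diag_det dA uU.
have uY : A + U \in unitmx by rewrite unitmxE detY unitfE.
pose Q := orthogonal_max (A + U).
have QX (i j : 'I_n) : (i < j)%N -> Q i j = s * X i j.
  move=> ij; apply/eqP; rewrite eq_le.
  (* Stationarity in the direction [c *: delta_mx i j]; the two signs of [c] give equality of the
     entries. *)
  have key (c : R) : c * (s * X i j) <= c * Q i j.
    have := dual_stationary (V := c *: delta_mx i j) uY uU minU.
    rewrite !mxinnerZl !(mxinnerC (delta_mx _ _)) !mxinner_delta mulrCA; apply.
    move=> k l lk; rewrite !mxE; case: (k =P i) => [ki|_]; last by rewrite mulr0.
    case: (l =P j) => [lj|_]; last by rewrite mulr0.
    by move: lk; rewrite ki lj leqNgt ij.
  by have := key 1; have := key (-1); rewrite !mulN1r !mul1r lerN2 => -> ->.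
exists Q; split=> //; first exact: (orthogonal_maxP (A + U)).1.
  have := dual_objective_ge U.
  have -> : dual_objective U = mxinner A Q.
    rewrite /dual_objective /nuclear_norm -/Q mxinnerDl -mxinnerZr.
    by rewrite (mxinner_strictly_upper (Y := s *: X) uU) ?addrK // => i j ij;
      rewrite mxE QX.
  have : 0 <= (1 - s) * nuclear_norm (A + U).
    by rewrite mulr_ge0 ?nuclear_ge0 // subr_ge0 ltW.
  by lra.
move=> A0; apply: (orthogonal_argmax_det (orthogonal_maxP (A + U))).
by rewrite detY.
Qed.

End DualProblem.
End Duality.

(** * Reduction to an invertible diagonal matrix and a strict contraction *)

Section Perturbation.
Context {R : realType} {n : nat}.
Implicit Types (A V X Y Z Q U : 'M[R]_n).

(** Replace the zero entries by [e]. If the product was zero and becomes negative, flipping the sign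
    of one replaced entry corrects it. *)
Lemma prod_perturb (d : 'I_n -> R) (e : R) : 0 < e -> exists d' : 'I_n -> R,
  [/\ forall i, `|d' i - d i| <= e, \prod_i d' i != 0 &
      0 <= \prod_i d i -> 0 < \prod_i d' i].
Proof.
move=> e0; pose d1 i := if d i == 0 then e else d i.
have d1e i : `|d1 i - d i| <= e.
  rewrite /d1; case: eqP => [->|_]; first by rewrite subr0 ger0_norm // ltW.
  by rewrite subrr normr0 ltW.
have d1_neq0 i : d1 i != 0.
  by rewrite /d1; case: (eqVneq (d i) 0) => // _; rewrite gt_eqF.
have prod_d1 : \prod_i d1 i != 0 by apply/prodf_neq0 => i _.
have [d1_gt0|d1_le0] := ltP 0 (\prod_i d1 i); first by exists d1.
have d1_lt0 : \prod_i d1 i < 0 by rewrite lt_def eq_sym prod_d1.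
have [d0|d_neq0] := eqVneq (\prod_i d i) 0; last first.
  exists d1; split=> //.
  have -> : \prod_i d1 i = \prod_i d i.
    by apply: eq_bigr => i _; rewrite /d1 (negbTE (prodf_neq0 _ _ d_neq0 i _)).
  by rewrite lt_def d_neq0.
have /prodf_eq0[k _ /eqP dk] : \prod_i d i == 0 by apply/eqP.
have d2_gt0 : 0 < \prod_i (if i == k then - d1 i else d1 i).
  rewrite (bigD1 k) //= eqxx mulNr oppr_gt0.
  rewrite (eq_bigr d1) => [|i /negbTE->//].
  by move: d1_lt0; rewrite (bigD1 k).
exists (fun i => if i == k then - d1 i else d1 i); split=> [i||//]; last first.
  by rewrite gt_eqF.
case: eqP => [->|_] //.
by rewrite dk subr0 normrN -[d1 k]subr0 -dk.
Qed.

Lemma orthogonal_dominates A X : is_diag_mx A -> nonexpansive_mx X -> exists Q,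
  [/\ orthogonal_mx Q, forall i j : 'I_n, (i < j)%N -> Q i j = X i j,
      mxinner A X <= mxinner A Q & 0 <= \det A -> \det Q = 1].
Proof.
move=> dA cX.
(* The determinant clause belongs to the compact set so that it survives the limit; it is vacuous
   when [\det A < 0]. *)
pose K := [set Q : 'M[R]_n | orthogonal_mx Q /\ (0 <= \det A -> \det Q = 1)].
have cK : compact K.
  have [A0|A0] := leP 0 (\det A).
    rewrite (_ : K = @orthogonal_mx R n `&` (fun Q => \det Q) @^-1` [set x | x = 1]).
      apply: compact_closedI; first exact: compact_orthogonal.
      by apply: preimage_closed => [Q _|]; [exact: continuous_det|exact: closed_eq].
    by apply/seteqP; split=> Q [oQ detQ]; split=> //; exact: detQ.
  rewrite (_ : K = @orthogonal_mx R n); first exact: compact_orthogonal.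
  by apply/seteqP; split=> [Q []//|Q oQ]; split=> //; rewrite leNgt A0.
(* Equality of the entries above the diagonal is encoded by the inequalities with [c = 1] and
   [c = -1]. *)
pose P V b := (V = A /\ b = mxinner A X) \/
  exists (i j : 'I_n) (c : R),
    [/\ (i < j)%N, `|c| <= 1, V = c *: delta_mx i j & b = c * X i j].
have [e e0|Q [oQ detQ] QP] := compact_approx_le (P := P) cK.
  pose N : R := \sum_(i < n) \sum_(j < n) 1.
  pose L := \sum_i \sum_j `|A i j|.
  have N0 : 0 <= N by do 2! apply: sumr_ge0 => ? _.
  have L0 : 0 <= L by do 2! apply: sumr_ge0 => ? _.
  have NL : 0 < 3 * N + L + 1 by lra.
  (* Exchanging [A] and [A'] costs [t * N] at [Q] and again at [X]; shrinking [X] costs at most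
     [t * (L + t * N)], and [t <= 1]. This totals at most [t * (3 * N + L)]. The added 1 covers the
     error [t] in single entries. *)
  pose t := Num.min 1 (e / (3 * N + L + 1)).
  have t0 : 0 < t by rewrite lt_min ltr01 divr_gt0.
  have t1 : t <= 1 by rewrite ge_min lexx.
  have te : t * (3 * N + L + 1) <= e.
    by rewrite -ler_pdivlMr // ge_min lexx orbT.
  have tN : 0 <= t * N by rewrite mulr_ge0 // ltW.
  have tL : 0 <= t * L by rewrite mulr_ge0 // ltW.
  have ttN : t * (t * N) <= t * N by rewrite ler_piMl.
  have [d [dAt d_neq0 d_gt0]] := prod_perturb (fun i => A i i) t0.
  pose A' : 'M[R]_n := diag_mx (\row_i d i).
  have detA : \det A = \prod_i A i i.
    by rewrite det_trig // is_diag_mx_is_trig.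
  have detA' : \det A' = \prod_i d i.
    by rewrite det_diag; apply: eq_bigr => i _; rewrite mxE.
  have A'A i j : `|(A' - A) i j| <= t.
    rewrite !mxE; have [->|ij] := eqVneq i j; first by rewrite mulr1n.
    by rewrite mulr0n (is_diag_mxP dA) // subrr normr0 ltW.
  have A'le Y : nonexpansive_mx Y -> `|mxinner A' Y - mxinner A Y| <= t * N.
    move=> cY; rewrite -mxinnerBl; apply: le_trans (mxinner_le _ _) _.
      by move=> i j; exact: nonexpansive_coord.
    rewrite mulr_sumr; apply: ler_sum => i _; rewrite mulr_sumr.
    by apply: ler_sum => j _; rewrite mulr1.
  have dA' : is_diag_mx A' by exact: diag_mx_is_diag.
  have s0 : 0 <= 1 - t by rewrite subr_ge0.
  have s1 : 1 - t < 1 by rewrite gtrBl.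
  have detA'_neq0 : \det A' != 0 by rewrite detA'.
  have [Q [oQ QX AQ detQ]] := orthogonal_dual dA' cX s0 s1 detA'_neq0.
  exists Q.
    by split=> // A0; apply: detQ; rewrite detA' d_gt0 // -detA.
  move=> V b [[-> ->]|[i [j [c [ij c1 -> ->]]]]]; last first.
    rewrite mxinnerZl mxinnerC mxinner_delta QX //.
    have cX1 : c * X i j <= 1.
      apply: le_trans (ler_norm _) _.
      by rewrite normrM mulr_ile1 // nonexpansive_coord.
    have : t * (c * X i j) <= t by rewrite ler_piMr // ltW.
    by lra.
  have : `|mxinner A X| <= L.
    by apply: mxinner_le => i j; exact: nonexpansive_coord.
  have := A'le X cX; have := A'le Q (orthogonal_nonexpansive oQ).
  rewrite !ler_norml => /andP[? ?] /andP[? ?] /andP[? ?].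
  have : t * mxinner A' X <= t * (L + t * N) by rewrite ler_pM2l //; lra.
  by lra.
exists Q; split=> // [i j ij|]; last by apply: QP; left.
have key c : `|c| <= 1 -> c * X i j <= c * Q i j.
  move=> c1; have := QP (c *: delta_mx i j) (c * X i j).
  rewrite mxinnerZl mxinnerC mxinner_delta; apply; right.
  by exists i, j, c.
apply/eqP; rewrite eq_le; have := key 1; have := key (-1).
by rewrite !mulN1r !mul1r lerN2 normrN normr1 lexx => -> // ->.
Qed.

End Perturbation.

(** * Comparison of the optimal values *)

Section Values.
Context {R : realType} {n : nat}.
Implicit Types (A V X Y Z Q U : 'M[R]_n) (S : set 'M[R]_n).
Implicit Type C : set 'rV[R]_#|upper_idx n|.

Lemma continuous_upper_proj : continuous (@upper_proj R n).
Proof.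
apply: mx_continuous => i j.
rewrite (_ : (fun _ => _) =
  fun X : 'M[R]_n => X (enum_val j).1 (enum_val j).2).
  exact: coord_continuous.
by apply/funext => X; rewrite mxE.
Qed.

Lemma eq_upper_proj X Y :
  (forall i j : 'I_n, (i < j)%N -> X i j = Y i j) -> upper_proj X = upper_proj Y.
Proof.
move=> XY; apply/rowP => k; rewrite !mxE XY //.
by have := enum_valP k; rewrite inE.
Qed.

Lemma sup_value_eq A S C X (r : R) : S X -> C (upper_proj X) ->
  r <= mxinner A X ->
  (forall Y, S Y -> C (upper_proj Y) -> mxinner A Y <= r) ->
  sup_value A S C = r%:E.
Proof.
move=> SX CX rX ler; apply/eqP; rewrite eq_le; apply/andP; split.
  by apply: ge_ereal_sup => _ [Y [SY CY] <-]; rewrite lee_fin; exact: ler.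
by apply: le_ereal_sup_tmp; exists (mxinner A X)%:E; rewrite ?lee_fin //; exists X.
Qed.

End Values.

Theorem theorem5 (R : realType) (n : nat) (A : 'M[R]_n)
    (C : set 'rV[R]_#|upper_idx n|)
    (diagA : is_diag_mx A)
    (subC : C `<=` [set upper_proj X | X in @op_ball R n])
    (neC : C !=set0)
    (closedC : closed C)
    (convexC : convex_set C) :
  exists2 m : \bar R, is_max_value A (@op_ball R n) C m &
    sup_value A (@orthogonal_mx R n) C = m /\
    (0 <= \det A ->
      sup_value A (@special_orthogonal_mx R n) C =
        sup_value A (@orthogonal_mx R n) C /\
      sup_value A (@orthogonal_mx R n) C = m).
Proof.
have dominated X : op_ball X -> C (upper_proj X) -> exists Q,
    [/\ orthogonal_mx Q, C (upper_proj Q), mxinner A X <= mxinner A Q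
      & 0 <= \det A -> \det Q = 1].
  move=> /op_ballP cX CX; have [Q [oQ QX AQ detQ]] := orthogonal_dominates diagA cX.
  by exists Q; split=> //; rewrite (eq_upper_proj QX).
have cK : compact (@orthogonal_mx R n `&` @upper_proj R n @^-1` C).
  apply: compact_closedI; first exact: compact_orthogonal.
  by apply: preimage_closed => // X _; exact: continuous_upper_proj.
have [|Q] := compact_EVT_max _ cK (continuous_subspaceT (@continuous_mxinner _ _ A)).
  (* Feasibility over the orthogonal matrices: a point of [C] lifts to the ball, and domination
     replaces the lift by an orthogonal matrix. *)
  have [c Cc] := neC; have [X bX Xc] := subC c Cc.
  by have [|Q [oQ CQ _ _]] := dominated X bX; [rewrite Xc|exists Q].
rewrite inE => -[oQ CQ] maxQ.
have Qmax Y : orthogonal_mx Y -> C (upper_proj Y) -> mxinner A Y <= mxinner A Q.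
  by move=> oY CY; apply: maxQ; rewrite inE.
have bQ : op_ball Q by apply/op_ballP; exact: orthogonal_nonexpansive.
have supO : sup_value A (@orthogonal_mx R n) C = (mxinner A Q)%:E.
  exact: sup_value_eq oQ CQ (lexx _) Qmax.
exists (mxinner A Q)%:E.
  split=> [|_ [X [bX CX] <-]]; first by exists Q.
  have [Y [oY CY XY _]] := dominated X bX CX.
  by rewrite lee_fin (le_trans XY) // Qmax.
split=> // A0; split=> //; rewrite supO.
(* Domination applied to the maximizer [Q] itself gives a feasible rotation with at least the same
   value. *)
have [Y [oY CY QY /(_ A0) detY]] := dominated Q bQ CQ.
by apply: (sup_value_eq (X := Y)) => // Z [oZ _]; exact: Qmax.
Qed.
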